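(* Let $G$ be a finite simple graph without isolated vertices, with vertex set $V(G)=\{t_1,\ldots,t_s\}$, $s\geq1$, let $S=K[t_1,\ldots,t_s]$ be a polynomial ring over a field $K$, and let $I(G)\subset S$ be the edge ideal of $G$. If $I(G)$ has a linear resolution, then $$\mathrm{v}(I(G))=\mathrm{reg}(S/I(G))=1.$$
   Context: The edge ideal $I(G)$ is the ideal of $S$ generated by all $t_it_j$ with $\{t_i,t_j\}\in E(G)$. An ideal $I$ generated by forms of degree $d$ has a ($d$-)linear resolution if in its minimal graded free resolution over $S$ the $i$-th free module is generated in degree $d+i$ for all $i\geq0$ (whenever nonzero); here $d=2$. With the standard grading $S=\bigoplus_{d\ge0}S_d$, and for $I\subsetneq\mathfrak{m}=(t_1,\ldots,t_s)$, the v-number is $\mathrm{v}(I)=\min\{d\geq 1\mid \exists f\in S_d\text{ and }\mathfrak{p}\in\mathrm{Ass}(I)\text{ with }(I\colon f)=\mathfrak{p}\}$, where $\mathrm{Ass}(I)$ is the set of associated primes of $S/I$ and $(I\colon f)=\{g\in S\mid gf\in I\}$. The regularity of $S/I$ is $\mathrm{reg}(S/I)=\max\{j-i\mid b_{i,j}\neq0\}$, where $b_{i,j}$ are the graded Betti numbers of the minimal graded free resolution of $S/I$ over $S$. *)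

(* Defs.v *)
From HB Require Import structures.
From mathcomp Require Import all_boot all_order all_algebra.
From mathcomp Require Import boolp classical_sets.
From mathcomp Require Import mpoly.

Set Implicit Arguments.
Unset Strict Implicit.
Unset Printing Implicit Defensive.

Import Order.TTheory GRing.Theory Num.Theory.

Local Open Scope ring_scope.

Section EdgeIdeal.

Variables (K : fieldType) (n : nat).

(* A graph on {t_1, ..., t_n} is its adjacency relation e; each edge
   contributes its monomial twice, as (i, j) and as (j, i). *)
Definition edge_ideal (e : rel 'I_n) : {pred {mpoly K[n]}} :=
  [pred f : {mpoly K[n]} |
    `[< exists c : 'I_n -> 'I_n -> {mpoly K[n]},
          f = \sum_(i < n) \sum_(j < n | e i j) c i j * ('X_i * 'X_j) >]].

End EdgeIdeal.

Arguments edge_ideal K {n} e _.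

Section VNumber.

Variables (K : fieldType) (n : nat).
Implicit Types (I p : {pred {mpoly K[n]}}).

Definition colon I (f : {mpoly K[n]}) : {pred {mpoly K[n]}} :=
  [pred g : {mpoly K[n]} | g * f \in I].

(* The annihilator of the class of g in S/I is (I : g); idealr_closed
   includes properness. *)
Definition associated_prime I p : Prop :=
  [/\ idealr_closed p, prime_idealr_closed p & exists g, p =i colon I g].

Definition v_degree I (d : nat) : Prop :=
  (1 <= d)%N /\
  exists (f : {mpoly K[n]}) (p : {pred {mpoly K[n]}}),
    [/\ f \is d.-homog, associated_prime I p & colon I f =i p].

(* The least element of the set of degrees; 0 if that set is empty. *)
Definition vnumber I : nat :=
  xget 0%N [set d : nat | v_degree I d /\
                          forall d' : nat, v_degree I d' -> (d <= d')%N]%classic.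

End VNumber.

Section Resolutions.

Variables (K : fieldType) (n : nat).

(* The data of ... -> F_2 -> F_1 -> F_0 -> M, where M = A/B is a graded
   subquotient of S.  F_i is free of rank rk i on basis elements of degrees
   gdeg i a; its elements are row vectors and maps act by right
   multiplication. The a-th basis element of F_0 goes to the class of aug a 0.
   As S lives in nonnegative degrees, so do the generators of a minimal
   resolution of A/B, hence degrees in nat are enough. *)
Record free_complex := FreeComplex {
  rk : nat -> nat;
  gdeg : forall i : nat, 'I_(rk i) -> nat;
  aug : 'cV[{mpoly K[n]}]_(rk 0);
  diff : forall i : nat, 'M[{mpoly K[n]}]_(rk i.+1, rk i)
}.

Definition graded_diff (F : free_complex) : Prop :=
  forall (i : nat) (a : 'I_(rk F i.+1)) (b : 'I_(rk F i)),
    diff F i a b = 0 \/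
    exists2 k : nat, gdeg a = (gdeg b + k)%N & diff F i a b \is k.-homog.

(* Graded free resolution of A/B, for homogeneous ideals B contained in A. *)
Definition graded_resolution (A B : {pred {mpoly K[n]}}) (F : free_complex)
    : Prop :=
  [/\ forall a : 'I_(rk F 0), aug F a 0 \in A /\ aug F a 0 \is (gdeg a).-homog,
      graded_diff F,
      forall f, f \in A -> exists v : 'rV_(rk F 0), f - (v *m aug F) 0 0 \in B,
      forall v : 'rV_(rk F 0),
        (v *m aug F) 0 0 \in B <-> exists w, v = w *m diff F 0
    & forall (i : nat) (v : 'rV_(rk F i.+1)),
        v *m diff F i = 0 <-> exists w, v = w *m diff F i.+1].

(* The entries of the differentials lie in (t_1, ..., t_n), that is, their
   constant coefficients vanish. *)
Definition minimal_resolution (A B : {pred {mpoly K[n]}}) (F : free_complex)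
    : Prop :=
  graded_resolution A B F /\
  forall (i : nat) (a : 'I_(rk F i.+1)) (b : 'I_(rk F i)), (diff F i a b)@_0 = 0.

Definition whole_ring : {pred {mpoly K[n]}} := predT.
Definition zero_ideal : {pred {mpoly K[n]}} := pred1 0.

(* The ideal I itself is the subquotient I/0. *)
Definition linear_resolution (d : nat) (I : {pred {mpoly K[n]}}) : Prop :=
  exists2 F : free_complex, minimal_resolution I zero_ideal F &
    forall (i : nat) (a : 'I_(rk F i)), gdeg a = (d + i)%N.

(* The graded Betti number b_{i,j}(A/B): the number of degree j basis elements
   of F_i, for a minimal resolution F of A/B (F is unique up to isomorphism). *)
Definition betti (A B : {pred {mpoly K[n]}}) (i j : nat) : nat :=
  xget 0%N [set b : nat | exists2 F : free_complex, minimal_resolution A B F &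
                            b = #|[set a : 'I_(rk F i) | gdeg a == j]%SET| ]%classic.

(* reg(S/I): the maximum of j - i over the pairs with b_{i,j}(S/I) <> 0;
   0 if there is no maximum. *)
Definition reg_quotient (I : {pred {mpoly K[n]}}) : int :=
  xget 0 [set r : int |
    (exists i j : nat, betti whole_ring I i j <> 0%N /\ r = j%:Z - i%:Z) /\
    (forall i j : nat, betti whole_ring I i j <> 0%N -> j%:Z - i%:Z <= r)]%classic.

End Resolutions.

(* Main.v *)
(* Regularity.  Prepending S -> S/I to the linear resolution of I gives a
   minimal resolution of S/I.  Any two minimal resolutions have generators in
   the same degrees: graded comparison maps f and g satisfy f g = 1 modulo the
   maximal ideal, because a homotopy contributes only entries of the
   differentials.  Hence reg(S/I) = 1.

   v-number.  If the non-neighbours of a vertex i are independent, then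
   (I : X_i) is the prime generated by the neighbours of i, and v(I) = 1.  As in
   Dirac's theorem, such a vertex exists unless the complement of G contains a
   path x, ..., y through non-neighbours (in the complement) of some u, with u
   joined to x and y but x not joined to y.  In that case, multiplying X_u X_x
   by the Koszul generator of the rest of the path gives a Koszul cycle on S/I
   off the linear strand; linearity of the resolution makes it a boundary, and
   summing the resulting cocycle over the triangles with apex u contradicts
   this. *)
Require Import Defs.
From HB Require Import structures.
From mathcomp Require Import all_boot all_order all_algebra.
From mathcomp Require Import boolp.
From mathcomp Require classical_sets.
From mathcomp Require Import mpoly.

Set Implicit Arguments.
Unset Strict Implicit.
Unset Printing Implicit Defensive.

Import Order.TTheory GRing.Theory Num.Theory.

Local Open Scope ring_scope.

(* x :: p is a path in the complement of the graph, and u is joined to its two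
   ends, but to no inner vertex, in the complement. *)
Definition fan (n : nat) (e : rel 'I_n) (u x : 'I_n) (p : seq 'I_n) : Prop :=
  [/\ uniq (u :: x :: p), path (fun i j => ~~ e i j) x p, e x (last x p),
      ~~ e u x /\ ~~ e u (last x p)
    & forall z, z \in x :: p -> z != x -> z != last x p -> e u z].

(** * Dirac's theorem for the complement of the graph *)

Section Dirac.

Variables (n : nat) (e : rel 'I_n).
Hypotheses (e_sym : ssrbool.symmetric e) (e_irr : irreflexive e).
Hypothesis no_fan : forall u x p, ~ fan e u x p.

Definition co_adj (A : {set 'I_n}) : rel 'I_n :=
  [rel x y | [&& x \in A, y \in A & ~~ e x y]].

Definition co_connected (A : {set 'I_n}) : Prop :=
  forall x y, x \in A -> y \in A -> connect (co_adj A) x y.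

Definition common_nbrs (T A : {set 'I_n}) : {set 'I_n} :=
  [set b in T | [forall c in A, e b c]].

Lemma connect_co_adjS (A B : {set 'I_n}) x y :
  A \subset B -> connect (co_adj A) x y -> connect (co_adj B) x y.
Proof.
move=> sAB; apply: connect_sub => {x y} x y /and3P[xA yA nxy].
by apply: connect1; apply/and3P; split=> //; exact: (subsetP sAB).
Qed.

Lemma co_connectedU1 (A : {set 'I_n}) c s :
  co_connected A -> c \in A -> ~~ e s c -> co_connected (s |: A).
Proof.
move=> cA cinA nsc.
have sc : connect (co_adj (s |: A)) s c.
  by apply: connect1; apply/and3P; split; rewrite ?inE ?eqxx ?cinA ?orbT.
have cs : connect (co_adj (s |: A)) c s.
  by apply: connect1; apply/and3P; split; rewrite 1?e_sym ?inE ?eqxx ?cinA ?orbT.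
have sub := subsetUr [set s] A.
move=> x y; rewrite !inE => /predU1P[->|xA] /predU1P[->|yA] //.
- exact: connect_trans sc (connect_co_adjS sub (cA _ _ cinA yA)).
- exact: connect_trans (connect_co_adjS sub (cA _ _ xA cinA)) cs.
- exact: connect_co_adjS sub (cA _ _ xA yA).
Qed.

(** Through [c], [A] and [d] there is a complement walk from [x] to [y]; shortened to a simple path,
    it forms a fan with apex [u] if [x] and [y] are adjacent. *)
Lemma no_fan_clique (A : {set 'I_n}) u x y c d :
  co_connected A -> (forall a, a \in A -> e u a) ->
  c \in A -> d \in A -> ~~ e x c -> ~~ e y d -> ~~ e u x -> ~~ e u y ->
  ~~ e x y.
Proof.
move=> cA uA cinA dinA nxc nyd nux nuy; apply/negP => exy.
pose B := x |: (y |: A).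
have sAB : A \subset B by apply/subsetP => z zA; rewrite !inE zA !orbT.
have /connectP[p0 pth0 lst0] : connect (co_adj B) x y.
  have xc : connect (co_adj B) x c.
    by apply: connect1; apply/and3P; split; rewrite ?inE ?eqxx ?cinA ?orbT.
  have dy : connect (co_adj B) d y.
    by apply: connect1; apply/and3P; split; rewrite 1?e_sym ?inE ?eqxx ?dinA ?orbT.
  exact: connect_trans xc (connect_trans (connect_co_adjS sAB (cA _ _ cinA dinA)) dy).
rewrite lst0 in exy nuy; case/shortenP: pth0 exy nuy lst0 => p pth up _ exy nuy yE.
have inB : {subset x :: p <= B}.
  have xB : x \in B by rewrite !inE eqxx.
  move=> z; rewrite inE => /predU1P[->//|zp].
  suff /allP/(_ _ zp) : all (mem B) p by [].
  by elim: (p) (x) pth => //= v q IHq w /andP[/and3P[_ vB _] /IHq ->]; rewrite vB.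
have uA' : u \notin A by apply/negP => /uA; rewrite e_irr.
have neux : u != x.
  by apply: contraTneq nxc => <-; rewrite negbK uA.
have neuy : u != y.
  by apply: contraTneq nyd => <-; rewrite negbK uA.
apply: (@no_fan u x p); split => //.
- rewrite [uniq _]/= -[(x \notin p) && uniq p]/(uniq (x :: p)) up andbT.
  apply/negP => /inB; rewrite !inE (negPf neux) (negPf neuy) /=.
  by rewrite (negPf uA').
- by apply: sub_path pth => ? ? /and3P[].
- move=> z /inB; rewrite -yE !inE => /or3P[/eqP->|/eqP->|/uA//];
  by rewrite eqxx.
Qed.

(** Induction on [#|T|]. Among the complement-connected sets with a common neighbour, take a maximal
    one [A]; a vertex found by induction among the common neighbours [B] of [A] also works for
    [T]. *)
Lemma simplicial_vertex (T : {set 'I_n}) : T != set0 ->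
  exists2 i, i \in T & forall j k, j \in T -> k \in T ->
    ~~ e i j -> ~~ e i k -> ~~ e j k.
Proof.
have [m] := ubnP #|T|; elim: m T => // m IHm T; rewrite ltnS => leTm T0.
have [/existsP[a /andP[aT]]|] :=
    boolP [exists a in T, [exists a' in T, e a a']]; last first.
  move=> none; have [i iT] := set0Pn _ T0; exists i => // j k jT kT _ _.
  apply: contra none => ejk; apply/existsP; exists j; rewrite jT.
  by apply/existsP; exists k; rewrite kT.
case/existsP => a' /andP[a'T eaa'].
pose P (A : {set 'I_n}) :=
  [&& A \subset T, A != set0, common_nbrs T A != set0 & `[< co_connected A >]].
have Pa : P [set a].
  apply/and4P; split; first by rewrite sub1set.
  - by apply/set0Pn; exists a; rewrite inE.
  - apply/set0Pn; exists a'; rewrite inE a'T; apply/forall_inP => c.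
    by rewrite inE => /eqP->; rewrite e_sym.
  - by apply/asboolP => x y; rewrite !inE => /eqP-> /eqP->.
have [A /maxsetP[/and4P[sAT A0 B0 /asboolP cA] maxA] _] := maxset_exists Pa.
set B := common_nbrs T A in B0.
have BA b c : b \in B -> c \in A -> e b c.
  by rewrite inE => /andP[_ /forall_inP]; apply.
have sBT : B \subset T by apply/subsetP => b; rewrite inE => /andP[].
have [c0 c0A] := set0Pn _ A0.
have ltBT : (#|B| < #|T|)%N.
  apply/proper_card/properP; split=> //; exists c0; first exact: (subsetP sAT).
  by apply/negP => /BA/(_ c0A); rewrite e_irr.
have [i iB simpl_i] := IHm B (leq_trans ltBT leTm) B0.
exists i => [|j k jT kT nij nik]; first exact: (subsetP sBT).
have notA z : ~~ e i z -> z \notin A by apply: contra; apply: BA.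
(* Adjoining such a [z] to [A] keeps it complement-connected, so by maximality [z] and [A] have no
   common neighbour. *)
have inS z : z \in T -> z \notin A -> z \notin B ->
    (exists2 c, c \in A & ~~ e z c) /\ (forall b, b \in B -> ~~ e b z).
  move=> zT zA; rewrite inE zT /= negb_forall_in => /exists_inP[c cinA nzc].
  split=> [|b bB]; first by exists c.
  apply/negP => ebz.
  suff zAE : z |: A = A by move: zA; rewrite -zAE !inE eqxx.
  apply: maxA (subsetUr _ _); apply/and4P; split.
  - by apply/subsetP => x; rewrite !inE => /predU1P[->//|/(subsetP sAT)].
  - by apply/set0Pn; exists z; rewrite !inE eqxx.
  - apply/set0Pn; exists b; rewrite inE (subsetP sBT) //.
    by apply/forall_inP => x; rewrite !inE => /predU1P[->//|]; apply: BA.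
  - exact/asboolP/(co_connectedU1 cA cinA nzc).
have [jB|jB] := boolP (j \in B); have [kB|kB] := boolP (k \in B).
- exact: simpl_i.
- by have [_] := inS k kT (notA _ nik) kB; apply.
- by have [_] := inS j jT (notA _ nij) jB; rewrite e_sym; apply.
(* With [j] and [k] both outside [B], an edge between them would give a fan with apex [i] and inner
   vertices in [A]. *)
have [[c cinA njc] _] := inS j jT (notA _ nij) jB.
have [[d dinA nkd] _] := inS k kT (notA _ nik) kB.
by apply: (no_fan_clique (u := i) cA _ cinA dinA) => // a'' ; apply: BA.
Qed.

End Dirac.

(** * Alternating functions on words and their signs *)

Section Alternating.

Variables (n : nat) (R : pzRingType) (V : lmodType R).
Implicit Types (f : seq 'I_n -> V) (B C D : seq 'I_n).

(* Alternating functions on words of length i stand for elements of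
   V (x) Lambda^i(K^n). *)
Definition alternating f : Prop :=
  forall C a b D, f (C ++ a :: b :: D) = - f (C ++ b :: a :: D)
                  /\ f (C ++ a :: a :: D) = 0.

Fixpoint inversions B : nat :=
  if B is x :: B' then (count (fun y : 'I_n => (y < x)%N) B' + inversions B')%N
  else 0%N.

(** [Q] is not assumed stable under prefixes, so the induction on [B] carries a prefix [E]; the head
    of [B] reaches its place by adjacent swaps ([Qfront]). *)
Lemma perm_adjacent_ind (Q : seq 'I_n -> seq 'I_n -> Prop) :
  (forall B, Q B B) -> (forall B2 B1 B3, Q B1 B2 -> Q B2 B3 -> Q B1 B3) ->
  (forall C a b D, Q (C ++ a :: b :: D) (C ++ b :: a :: D)) ->
  forall B B', perm_eq B B' -> Q B B'.
Proof.
move=> Qrefl Qtrans Qswap.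
have Qfront E x C D : Q (E ++ x :: C ++ D) (E ++ C ++ x :: D).
  elim: C E => [|y C IHC] E //=.
  by apply: (Qtrans _ _ _ (Qswap _ _ _ _)); have := IHC (rcons E y); rewrite !cat_rcons.
suff Qcat B : forall E B', perm_eq B B' -> Q (E ++ B) (E ++ B').
  by move=> B B'; apply: (Qcat _ [::]).
elim: B => [|x B IHB] E B' eqB.
  by rewrite (perm_nilP (s := B') _) // perm_sym.
have xB' : x \in B' by rewrite -(perm_mem eqB) mem_head.
case/splitPr: xB' eqB => C D.
rewrite -[x :: D]cat1s perm_sym perm_catCA perm_cons perm_sym => eqB.
apply: Qtrans (Qfront E x C D); have := IHB (rcons E x) _ eqB.
by rewrite !cat_rcons.
Qed.

(** The swap reverses the comparison of [a] with [b] and no other. *)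
Lemma odd_inversions_swap C a b D : a != b ->
  odd (inversions (C ++ a :: b :: D)) = ~~ odd (inversions (C ++ b :: a :: D)).
Proof.
move=> neab; elim: C => [|x C IHC] /=; last first.
  by rewrite !oddD IHC !count_cat /= (addnCA (a < x)%N) addbN.
have: (b < a)%N = ~~ (a < b)%N.
  by move: neab; rewrite -(inj_eq val_inj) /=; case: ltngtP.
rewrite !oddD => ->; case: (a < b)%N => /=;
by do 3!case: (odd _).
Qed.

Lemma alternating_perm f B B' : alternating f -> perm_eq B B' ->
  f B = (-1) ^+ (inversions B + inversions B') *: f B'.
Proof.
move=> fA; move: B B'.
apply: (perm_adjacent_ind (Q := fun B B' =>
  f B = (-1) ^+ (inversions B + inversions B') *: f B'))
  => [B|B2 B1 B3 -> ->|C a b D].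
- by rewrite addnn -mul2n exprM sqrrN expr1n expr1n scale1r.
- rewrite scalerA -exprD -signr_odd -[in RHS]signr_odd !oddD.
  by do 3!case: (odd _).
have [->|neab] := eqVneq a b.
  by rewrite (fA C b b D).2 scaler0.
rewrite (fA C a b D).1 -signr_odd oddD odd_inversions_swap //.
by case: (odd _); rewrite expr1 scaleN1r.
Qed.

Lemma alternating_perm0 f B B' : alternating f -> perm_eq B B' ->
  f B' = 0 -> f B = 0.
Proof. by move=> fA eqB f0; rewrite (alternating_perm fA eqB) f0 scaler0. Qed.

(** Adjacent swaps bring two equal letters to the front. There the second clause of [alternating]
    applies, which in characteristic 2 does not follow from the first. *)
Lemma alternating_nuniq f B : alternating f -> ~~ uniq B -> f B = 0.
Proof.
move=> fA nuB.
have [a [C eqB]] : exists a C, perm_eq B [:: a, a & C].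
  elim: B nuB => //= x B IHB; rewrite negb_and negbK; case: (boolP (x \in B)).
    move=> xB _; exists x, (rem x B); rewrite perm_cons; exact: perm_to_rem.
  move=> _ /= /IHB[a [C eqB]]; exists a, (x :: C).
  by rewrite -(perm_cons x) in eqB; rewrite (permPl eqB)
     -[[:: a, a & C]]/([:: a; a] ++ C)
     -[[:: x, a & _]]/([:: x] ++ [:: a; a] ++ C) perm_catCA.
exact: alternating_perm0 fA eqB (fA [::] a a C).2.
Qed.

Lemma alternatingB f g :
  alternating f -> alternating g -> alternating (fun B => f B - g B).
Proof.
move=> fA gA C a b D; split; first by rewrite (fA C a b D).1 (gA C a b D).1 opprD.
by rewrite (fA C a b D).2 (gA C a b D).2 subrr.
Qed.

(** Extends arbitrary values on sorted words: an adjacent swap keeps the sorted word and changes the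
    parity of the inversions. *)
Lemma alternating_sort f :
  alternating (fun B => if uniq B then (-1) ^+ inversions B *:
      f (sort (fun i j : 'I_n => i <= j)%N B) else 0).
Proof.
move=> C a b D.
have neq_perm x : perm_eq (C ++ a :: x :: D) (C ++ x :: a :: D).
  by rewrite perm_cat2l -[_ :: _]/([:: a] ++ [:: x] ++ D) perm_catCA.
split; last by rewrite cat_uniq /= inE eqxx /= !andbF.
rewrite (perm_uniq (neq_perm b)).
case: ifP => [uB|]; last by rewrite oppr0.
have neab : a != b.
  by apply: contraTneq uB => ->; rewrite cat_uniq /= inE eqxx /= !andbF.
rewrite -[in LHS]signr_odd odd_inversions_swap // -[in RHS]signr_odd -scaleNr.
have /perm_sortP -> := neq_perm b.
- by case: (odd _); rewrite /= ?expr0 ?expr1 ?opprK.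
- by move=> i j; apply: leq_total.
- by move=> i j k; apply: leq_trans.
- by move=> i j; rewrite -eqn_leq => /eqP/val_inj.
Qed.

End Alternating.

(** * Coefficients and homogeneous components of polynomials *)

Section Coefficients.

Variables (K : fieldType) (n : nat).
Implicit Types (p q : {mpoly K[n]}) (m : 'X_{1..n}).

Lemma mcoeffMX_if p m k :
  (p * 'X_[m])@_k = if (m <= k)%MM then p@_(k - m)%MM else 0.
Proof.
case: ifPn => [lemk|nle]; first by rewrite -{1}(submK lemk) addmC mcoeffMX.
apply: memN_msupp_eq0; rewrite (perm_mem (msuppMX p m)).
by apply: contra nle => /mapP[m' _ ->]; exact: lem_addr.
Qed.

(** Only the variables dividing [m], listed by [s], contribute. *)
Lemma mcoeff_sumXM (f : 'I_n -> {mpoly K[n]}) (s : seq 'I_n) m :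
  uniq s -> (forall i, (0 < m i)%N = (i \in s)) ->
  (\sum_i 'X_i * f i)@_m = \sum_(i <- s) (f i)@_(m - U_(i))%MM.
Proof.
move=> us ms; rewrite [RHS]big_uniq // raddf_sum [RHS]big_mkcond /=.
apply: eq_bigr => i _; rewrite mulrC mcoeffMX_if -ms.
suff -> : (U_(i) <= m)%MM = (0 < m i)%N by [].
apply/mnm_lepP/idP => [/(_ i)|mi j]; first by rewrite mnm1E eqxx.
by rewrite mnm1E; case: eqP => // <-.
Qed.

Lemma dhomog1_sum p : p \is 1.-homog -> p = \sum_i p@_U_(i) *: 'X_i.
Proof.
move=> hp; apply/mpolyP => m; rewrite raddf_sum /=.
have [/mdeg1P[i /eqP->]|dm] := boolP (mdeg m == 1%N).
  rewrite (bigD1 i) //= mcoeffZ mcoeffX eqxx mulr1 big1 ?addr0 // => j ji.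
  rewrite mcoeffZ mcoeffX; case: eqP => [/mnmP/(_ j)|]; last by rewrite mulr0.
  by rewrite !mnm1E eqxx eq_sym (negPf ji).
rewrite (dhomog_nemf_coeff hp dm) big1 // => j _; rewrite mcoeffZ mcoeffX.
by case: (U_(j)%MM =P m) dm => [<-|]; rewrite ?mdeg1 ?mulr0.
Qed.

Lemma pihomogM e k p q : q \is k.-homog ->
  pihomog mdeg e (p * q) =
  if (k <= e)%N then pihomog mdeg (e - k) p * q else 0.
Proof.
move=> hq; rewrite {1}(pihomog_partitionE (leq_addr (e - k).+1 (mmeasure mdeg p))).
rewrite mulr_suml raddf_sum /=.
have piM d : pihomog mdeg e (pihomog mdeg d p * q) =
    if (d + k == e)%N then pihomog mdeg d p * q else 0.
  have hM : pihomog mdeg d p * q \is (d + k).-homog.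
    by apply: dhomogM => //; exact: pihomogP.
  have [<-|ne] := eqVneq (d + k)%N e; first by rewrite pihomog_dE.
  exact: pihomog_ne0 ne hM.
under eq_bigr do rewrite piM.
case: leqP => [leke|ltek]; last first.
  by rewrite big1 // => d _; rewrite ifN // gtn_eqF // (leq_trans ltek) ?leq_addl.
rewrite -big_mkcond /=.
have dE (d : nat) : (d + k == e)%N = (d == e - k)%N.
  by rewrite -{1}(subnK leke) eqn_add2r.
under eq_bigl do rewrite dE.
have lt : (e - k < mmeasure mdeg p + (e - k).+1)%N by rewrite addnS ltnS leq_addl.
by rewrite (big_pred1 (Ordinal lt)).
Qed.

Definition mx_homog d r s (M : 'M[{mpoly K[n]}]_(r, s)) : Prop :=
  forall a b, M a b \is d.-homog.

Lemma mx_homogM d k r s t (M : 'M[{mpoly K[n]}]_(r, s))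
    (N : 'M[{mpoly K[n]}]_(s, t)) :
  mx_homog d M -> mx_homog k N -> mx_homog (d + k) (M *m N).
Proof.
by move=> hM hN a b; rewrite mxE rpred_sum // => c _; apply: dhomogM.
Qed.

Lemma mx_homogB d r s (M N : 'M[{mpoly K[n]}]_(r, s)) :
  mx_homog d M -> mx_homog d N -> mx_homog d (M - N).
Proof. by move=> hM hN a b; rewrite !mxE rpredB. Qed.

Lemma mx_homog_sign d r s k (M : 'M[{mpoly K[n]}]_(r, s)) :
  mx_homog d M -> mx_homog d ((-1) ^+ k *: M).
Proof.
move=> hM; rewrite -signr_odd; case: (odd k); last by rewrite expr0 scale1r.
by move=> a b; rewrite expr1 scaleN1r mxE rpredN; apply: hM.
Qed.

Lemma map_pihomogM d k r s t (M : 'M[{mpoly K[n]}]_(r, s))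
    (N : 'M[{mpoly K[n]}]_(s, t)) : mx_homog k N ->
  map_mx (pihomog mdeg (d + k)) (M *m N) = map_mx (pihomog mdeg d) M *m N.
Proof.
move=> hN; apply/matrixP => a b; rewrite !mxE raddf_sum /=.
by apply: eq_bigr => c _; rewrite !mxE (pihomogM _ _ (hN c b)) leq_addl addnK.
Qed.

End Coefficients.

(** * The Koszul complex with coefficients in a free module *)

Section Koszul.

Variables (K : fieldType) (n : nat).
Local Notation S := {mpoly K[n]}.

(** The Koszul differential in all homological degrees at once: values on words of length k + 1
    determine those on words of length k. *)
Definition koszul r (z : seq 'I_n -> 'rV[S]_r) (B : seq 'I_n) : 'rV[S]_r :=
  \sum_i 'X_i *: z (i :: B).

Lemma alternating_koszul r (z : seq 'I_n -> 'rV[S]_r) :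
  alternating z -> alternating (koszul z).
Proof.
move=> zA C a b D; split.
  rewrite /koszul -sumrN; apply: eq_bigr => i _.
  by rewrite (zA (i :: C) a b D).1 scalerN.
by apply: big1 => i _; rewrite (zA (i :: C) a b D).2 scaler0.
Qed.

(** The terms at (i, j) and (j, i) cancel; antisymmetry alone does not kill the diagonal in
    characteristic 2. *)
Lemma sum_antisymmetric (V : zmodType) (F : 'I_n -> 'I_n -> V) :
  (forall i, F i i = 0) -> (forall i j, F i j = - F j i) ->
  \sum_i \sum_j F i j = 0.
Proof.
move=> F0 FN.
have split_sum i : \sum_j F i j =
    \sum_(j < n | (i < j)%N) F i j + \sum_(j < n | (j < i)%N) F i j.
  rewrite (bigID (fun j : 'I_n => (i < j)%N)) /=; congr (_ + _).
  rewrite (bigD1 i) ?ltnn //= F0 add0r; apply: eq_bigl => j.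
  by rewrite -leqNgt ltn_neqAle andbC -(inj_eq val_inj).
rewrite (eq_bigr _ (fun i _ => split_sum i)) big_split /=.
rewrite [X in _ + X](exchange_big_dep predT) //= -big_split big1 //= => i _.
by rewrite -big_split big1 //= => j _; rewrite (FN i j) addNr.
Qed.

Lemma koszulK r (z : seq 'I_n -> 'rV[S]_r) B : alternating z ->
  koszul (koszul z) B = 0.
Proof.
move=> zA; rewrite /koszul; under eq_bigr do rewrite scaler_sumr.
apply: sum_antisymmetric => [i|i j]; first by rewrite (zA [::] i i B).2 !scaler0.
by rewrite (zA [::] j i B).1 !scalerN !scalerA mulrC.
Qed.

Lemma koszulB r (y z : seq 'I_n -> 'rV[S]_r) B :
  koszul (fun C => y C - z C) B = koszul y B - koszul z B.
Proof. by rewrite -sumrB; apply: eq_bigr => i _; rewrite scalerBr. Qed.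

Lemma koszulM r s (z : seq 'I_n -> 'rV[S]_r) (D : 'M[S]_(r, s)) B :
  koszul (fun C => z C *m D) B = koszul z B *m D.
Proof. by rewrite mulmx_suml; apply: eq_bigr => i _; rewrite scalemxAl. Qed.

Lemma koszul_homog d r (z : seq 'I_n -> 'rV[S]_r) B :
  (forall C, mx_homog d (z C)) -> mx_homog (1 + d) (koszul z B).
Proof.
move=> hz a b; rewrite summxE rpred_sum // => i _; rewrite mxE.
by apply: dhomogM; [rewrite dhomogX /= mdeg1 | apply: hz].
Qed.

(** Compare the coefficients of the squares and of the products of two distinct variables. *)
Lemma sum_X_linear_eq0 (f : 'I_n -> S) : \sum_i 'X_i * f i = 0 ->
  (forall i, (f i)@_U_(i) = 0) /\
  (forall i j, (f i)@_U_(j) = - (f j)@_U_(i)).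
Proof.
move=> f0.
have fii i : (f i)@_U_(i) = 0.
  have := mcoeff_sumXM f (s := [:: i]) (m := (U_(i) + U_(i))%MM) isT.
  rewrite f0 mcoeff0 big_seq1 addmK => -> // j.
  by rewrite mnmDE !mnm1E inE eq_sym; case: eqP.
split=> // i j; have [->|neij] := eqVneq i j; first by rewrite fii oppr0.
have := mcoeff_sumXM f (s := [:: i; j]) (m := (U_(i) + U_(j))%MM).
rewrite f0 mcoeff0 big_cons big_seq1 addmK addmC addmK /= inE neij.
move=> /(_ isT) fij; apply/eqP; rewrite -addr_eq0 -fij // => l.
by rewrite mnmDE !mnm1E !inE ![l == _]eq_sym; do 2!case: eqP.
Qed.

(** With [y (i :: C)] the coefficient of ['X_i] in [z C], linearity of [z] gives [koszul y = z]; the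
    cycle condition makes [y] alternating in its first two letters. *)
Lemma koszul_linear_exact r (z : seq 'I_n -> 'rV[S]_r) :
  alternating z -> (forall B, mx_homog 1 (z B)) ->
  (forall B, koszul z B = 0) ->
  exists y, [/\ alternating y, forall B, mx_homog 0 (y B)
              & forall B, z B = koszul y B].
Proof.
move=> zA hz z0.
(* The value at the empty word is never read by [koszul]. *)
pose y B : 'rV[S]_r :=
  if B is i :: C then map_mx (fun p : S => (p@_U_(i))%:MP) (z C) else 0.
have zcoef B a : (forall i, (z (i :: B) 0 a)@_U_(i) = 0) /\
    (forall i j, (z (i :: B) 0 a)@_U_(j) = - (z (j :: B) 0 a)@_U_(i)).
  apply: sum_X_linear_eq0; have /rowP/(_ a) := z0 B.
  rewrite [RHS]mxE; apply: etrans.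
  by rewrite summxE; apply: eq_bigr => i _; rewrite mxE.
exists y; split.
- move=> [|i C] a b D /=.
    split; apply/rowP => c; rewrite !mxE.
      by rewrite (zcoef D c).2 mpolyCN.
    by rewrite (zcoef D c).1 mpolyC0.
  split; apply/rowP => c; rewrite !mxE.
    by rewrite (zA C a b D).1 mxE mcoeffN mpolyCN.
  by rewrite (zA C a b D).2 mxE mcoeff0 mpolyC0.
- move=> [|i C] a b; rewrite mxE ?rpred0 //.
  by rewrite -[_%:MP]mulr1 mul_mpolyC dhomogZ ?dhomog1.
move=> B; apply/rowP => a; rewrite [LHS]dhomog1_sum //; last exact: hz.
rewrite summxE; apply: eq_bigr => i _.
by rewrite !mxE mulrC mul_mpolyC.
Qed.

(** As [D] and [q] are homogeneous, the degree 1 part of a preimage is again a preimage. Lifting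
    zero to zero preserves bounds on word length, which the zigzag induction needs. *)
Lemma alternating_lift k r s (D : 'M[S]_(r, s)) (q : seq 'I_n -> 'rV[S]_s) :
  mx_homog k D -> alternating q -> (forall B, mx_homog (1 + k) (q B)) ->
  (forall B, exists w, q B = w *m D) ->
  exists z, [/\ alternating z, forall B, mx_homog 1 (z B),
                forall B, q B = z B *m D & forall B, q B = 0 -> z B = 0].
Proof.
move=> hD qA hq qD.
have /choice[w wP] : forall B, exists w,
    [/\ mx_homog 1 w, q B = w *m D & q B = 0 -> w = 0].
  move=> B; have [q0|q0] := eqVneq (q B) 0.
    by exists 0; rewrite mul0mx; split=> // a b; rewrite mxE rpred0.
  have [w qw] := qD B; exists (map_mx (pihomog mdeg 1) w); split.
  - by move=> a b; rewrite mxE pihomogP.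
  - rewrite -(map_pihomogM 1 _ hD) -qw; apply/matrixP => a b; rewrite mxE.
    by rewrite pihomog_dE //; apply: hq.
  - by move/eqP; rewrite (negPf q0).
pose ord_sort := sort (fun i j : 'I_n => i <= j)%N.
(* Lifting only sorted words and extending by signs keeps z alternating. *)
exists (fun B => if uniq B then (-1) ^+ inversions B *:
  ((-1) ^+ inversions (ord_sort B) *: w (ord_sort B)) else 0).
have sortB B : perm_eq B (ord_sort B) by rewrite perm_sym perm_sort.
split.
- exact: (alternating_sort (fun B => (-1) ^+ inversions B *: w B)).
- move=> B; case: ifP => _; last by move=> a b; rewrite mxE rpred0.
  by have [hw _ _] := wP (ord_sort B); do 2!apply: mx_homog_sign.
- move=> B; case: ifPn => [_|nu]; last by rewrite mul0mx (alternating_nuniq qA).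
  rewrite (alternating_perm qA (sortB B)) exprD -scalerA -!scalemxAl.
  by have [_ <- _] := wP (ord_sort B).
- move=> B q0; case: ifP => // _.
  have [_ _ ->] := wP (ord_sort B); first by rewrite !scaler0.
  by apply: alternating_perm0 qA _ q0; rewrite perm_sym.
Qed.

End Koszul.

(** * Closure properties and coefficients of the edge ideal *)

Section EdgeIdealTheory.

Variables (K : fieldType) (n : nat) (e : rel 'I_n).
Local Notation S := {mpoly K[n]}.
Implicit Types (f g : S).

Lemma edge_idealP f : reflect
  (exists c : 'I_n -> 'I_n -> S,
     f = \sum_i \sum_(j | e i j) c i j * ('X_i * 'X_j))
  (f \in edge_ideal K e).
Proof. exact: asboolP. Qed.

Lemma edge_ideal0 : 0 \in edge_ideal K e.
Proof.
apply/edge_idealP; exists (fun _ _ => 0).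
by rewrite big1 // => i _; rewrite big1 // => j _; rewrite mul0r.
Qed.

Lemma edge_ideal_lin a : {in edge_ideal K e &, forall f g,
  a * f + g \in edge_ideal K e}.
Proof.
move=> f g /edge_idealP[c ->] /edge_idealP[d ->]; apply/edge_idealP.
exists (fun i j => a * c i j + d i j); rewrite mulr_sumr -big_split.
apply: eq_bigr => i _; rewrite mulr_sumr -big_split; apply: eq_bigr => j _ /=.
by rewrite mulrDl mulrA.
Qed.

Lemma edge_idealD :
  {in edge_ideal K e &, forall f g, f + g \in edge_ideal K e}.
Proof. by move=> f g fI gI; rewrite -[f]mul1r edge_ideal_lin. Qed.

Lemma edge_idealMl a : {in edge_ideal K e, forall f, a * f \in edge_ideal K e}.
Proof. by move=> f fI; rewrite -[_ * _]addr0 edge_ideal_lin ?edge_ideal0. Qed.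

Lemma edge_ideal_sum (I : Type) (r : seq I) (P : pred I) (F : I -> S) :
  (forall i, P i -> F i \in edge_ideal K e) ->
  \sum_(i <- r | P i) F i \in edge_ideal K e.
Proof.
by move=> FI; elim/big_ind: _ => //; [exact: edge_ideal0 | exact: edge_idealD].
Qed.

Lemma edge_idealX i j : e i j -> 'X_i * 'X_j \in edge_ideal K e.
Proof.
move=> eij; apply/edge_idealP; exists (fun k l => ((k == i) && (l == j))%:R).
rewrite (bigD1 i) //= (bigD1 j) //= !eqxx mul1r.
rewrite big1 ?addr0 => [|l /andP[_ /negPf->]]; last by rewrite mul0r.
by rewrite big1 ?addr0 // => k /negPf->; rewrite big1 // => l _; rewrite mul0r.
Qed.

Lemma edge_ideal_mulmx r s (M : 'M[S]_(r, s)) (N : 'cV[S]_s) :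
  (forall b, N b 0 \in edge_ideal K e) ->
  forall a, (M *m N) a 0 \in edge_ideal K e.
Proof.
by move=> NI a; rewrite mxE edge_ideal_sum // => b _; apply: edge_idealMl.
Qed.

Lemma pihomog_edge_ideal d f :
  f \in edge_ideal K e -> pihomog mdeg d f \in edge_ideal K e.
Proof.
case/edge_idealP => c ->; rewrite raddf_sum edge_ideal_sum // => i _.
rewrite raddf_sum edge_ideal_sum // => j eij.
have hXX : 'X_i * 'X_j \is [in K[n], 2.-homog].
  by rewrite -mpolyXD dhomogX /= mdegD !mdeg1.
rewrite /= (pihomogM _ _ hXX).
by case: ifP => _; [rewrite edge_idealMl ?edge_idealX | exact: edge_ideal0].
Qed.

(** No edge monomial divides ['X_a * 'X_b]. *)
Lemma mcoeff_edge_ideal a b f : ssrbool.symmetric e -> a != b -> ~~ e a b ->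
  f \in edge_ideal K e -> f@_(U_(a) + U_(b))%MM = 0.
Proof.
move=> e_sym neab nab /edge_idealP[c ->]; rewrite raddf_sum big1 // => i _.
rewrite raddf_sum big1 //= => j eij; rewrite -mpolyXD mcoeffMX_if ifN //.
apply/negP => /mnm_lepP le; have := le i; have := le j.
rewrite !mnmDE !mnm1E !eqxx; have [ai|_] := eqVneq a i; subst.
  by rewrite leq_add2l lt0b => /eqP bj; rewrite bj eij in nab.
have [bi|_] := eqVneq b i; last by case: (j == i).
by subst; rewrite addnC leq_add2r lt0b => /eqP aj; rewrite aj e_sym eij in nab.
Qed.

End EdgeIdealTheory.

(** * Koszul cycles along a linear complex *)

Section LinearZigzag.

Variables (K : fieldType) (n : nat).
Local Notation S := {mpoly K[n]}.
Variables (r : nat -> nat) (D : forall j, 'M[S]_(r j.+1, r j)).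
Hypothesis D_exact : forall j (v : 'rV_(r j.+1)),
  v *m D j = 0 <-> exists w, v = w *m D j.+1.
Hypothesis D_linear : forall j, mx_homog 1 (D j.+1).

(* The double complex chase showing that the Koszul homology of a module with
   a linear resolution vanishes off the linear strand. *)
Lemma linear_zigzag L j (z : seq 'I_n -> 'rV[S]_(r j.+1)) :
  alternating z -> (forall B, mx_homog 1 (z B)) ->
  (forall B, (L <= size B)%N -> z B = 0) ->
  (forall B, koszul z B *m D j = 0) ->
  exists2 y, alternating y /\ (forall B, mx_homog 0 (y B)) &
    forall B, exists w, z B = koszul y B + w *m D j.+1.
Proof.
elim: L j z => [|L IHL] j z zA hz z0 zD.
  (* For [L = 0] the function [z] vanishes on all words. *)
  exists (fun _ => 0).
    by split=> [C a b E|B a b]; rewrite ?oppr0 // mxE rpred0.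
  move=> B; exists 0; rewrite z0 // mul0mx addr0 /koszul big1 // => i _.
  exact: scaler0.
(* The lift [z'] vanishes already from length [L] on, since [koszul z B] reads [z] at words one
   letter longer than [B]; so the induction hypothesis applies at level [j.+1]. *)
have [z' [zA' hz' zz' z'0]] := alternating_lift (@D_linear j)
  (alternating_koszul zA) (fun B => koszul_homog B hz) (fun B => (D_exact _).1 (zD B)).
have DD i : D i.+1 *m D i = 0.
  apply/row_matrixP => a; rewrite row_mul row0.
  by apply/(D_exact _).2; exists (delta_mx 0 a); rewrite rowE.
have [||y' [yA hy] z'E] := IHL j.+1 z' zA' hz'.
- move=> B leLB; apply: z'0; rewrite /koszul big1 // => i _.
  by rewrite z0 ?scaler0.
- move=> B; rewrite -koszulM -[RHS](koszulK B zA).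
  by apply: eq_bigr => i _; rewrite zz'.
(* Subtracting the image of [y'] turns [z] into a linear Koszul cycle, because consecutive
   differentials compose to zero. *)
have dA : alternating (fun B => z B - y' B *m D j.+1).
  apply: alternatingB => // C a b E; rewrite (yA C a b E).1 (yA C a b E).2.
  by rewrite mulNmx mul0mx.
have [||y [yA' hy' zE]] := koszul_linear_exact dA.
- by move=> B; apply: mx_homogB => //; apply: (mx_homogM (d := 0)).
- move=> B; rewrite koszulB koszulM zz'; have [w ->] := z'E B.
  by rewrite mulmxDl -mulmxA DD mulmx0 addr0 subrr.
exists y => // B; exists (y' B).
by rewrite -zE subrK.
Qed.

End LinearZigzag.

(** * A linear resolution excludes fans *)

Section NoFan.

Variables (K : fieldType) (n : nat) (e : rel 'I_n).
Local Notation S := {mpoly K[n]}.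
Hypotheses (e_sym : ssrbool.symmetric e) (e_irr : irreflexive e).
Variables (r : nat -> nat) (A : 'cV[S]_(r 0)).
Variable (D : forall j, 'M[S]_(r j.+1, r j)).
Hypothesis A_edge : forall a, A a 0 \in edge_ideal K e.
Hypothesis A_homog : mx_homog 2 A.
Hypothesis A_gen : forall f, f \in edge_ideal K e -> exists w, f%:M = w *m A.
Hypothesis A_exact : forall v : 'rV_(r 0), v *m A = 0 <-> exists w, v = w *m D 0.
Hypothesis D_exact : forall j (v : 'rV_(r j.+1)),
  v *m D j = 0 <-> exists w, v = w *m D j.+1.
Hypothesis D_linear : forall j, mx_homog 1 (D j).

(** For duplicate-free [s], up to sign, the exterior product of the letters of [s] as an alternating
    function. *)
Definition perm_sign (s B : seq 'I_n) : K :=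
  if perm_eq B s then (-1) ^+ inversions B else 0.

Lemma alternating_perm_sign s (v : 'rV[S]_1) : uniq s ->
  alternating (fun B => (perm_sign s B)%:MP *: v).
Proof.
move=> us C a b E; rewrite /perm_sign.
have eqab : perm_eq (C ++ a :: b :: E) (C ++ b :: a :: E).
  by rewrite perm_cat2l -[_ :: _]/([:: a] ++ [:: b] ++ E) perm_catCA.
split; last first.
  case: ifP => [/perm_uniq|]; last by rewrite scale0r.
  by rewrite us cat_uniq /= inE eqxx !andbF.
rewrite (permPl eqab); case: ifP => [pB|]; last by rewrite scale0r oppr0.
have neab : a != b.
  move: us; rewrite -(perm_uniq pB); apply: contraTneq => ->.
  by rewrite cat_uniq /= inE eqxx /= !andbF.
rewrite -signr_odd -[in RHS]signr_odd odd_inversions_swap //.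
by case: (odd _); rewrite /= ?expr0 ?expr1 mpolyCN scaleNr ?opprK.
Qed.

(* A fan is a subdivided circle in the complement, coned off from u: the
   monomial X_u X_x times the sign character of p is a Koszul cycle modulo the
   edge ideal, and pairing it with the circle shows that it does not bound. *)
Lemma linear_no_fan u x p : ~ fan e u x p.
Proof.
case=> /andP[uW /[dup] uxp /andP[xp up]] pth exl [nux nul] int.
set l := last x p in exl nul int.
have neux : u != x by apply: contraNneq uW => ->; rewrite mem_head.
have lp : l \in x :: p by rewrite mem_last.
have nelx : l != x by apply: contraTneq exl => ->; rewrite e_irr.
have nelu : u != l by apply: contraNneq uW => ->.
pose E B : 'rV[S]_1 := (perm_sign p B)%:MP *: ('X_u * 'X_x)%:M.
have EA : alternating E by exact: alternating_perm_sign.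
have hE B : mx_homog 2 (E B).
  move=> a b; rewrite !mxE mul_mpolyC dhomogZ // -mpolyXD.
  by case: eqP => _; rewrite ?rpred0 //= mulr1n dhomogX /= mdegD !mdeg1.
(* Each letter of [p] completes an edge: the last vertex [l] with [x], every other one with [u]. *)
have EI B : exists w, koszul E B = w *m A.
  suff /A_gen[w wE] : koszul E B 0 0 \in edge_ideal K e.
    by exists w; rewrite -wE -mx11_scalar.
  rewrite summxE edge_ideal_sum // => m _; rewrite !mxE mulr1n.
  rewrite /perm_sign; case: ifPn => [pm|_]; last first.
    by rewrite mpolyC0 mul0r mulr0 edge_ideal0.
  rewrite mulrCA; apply: edge_idealMl.
  have mp : m \in p by rewrite -(perm_mem pm) mem_head.
  have nemx : m != x by apply: contraNneq xp => <-.
  have [ml|neml] := eqVneq m l.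
    by rewrite mulrCA edge_idealMl // mulrC ml edge_idealX.
  rewrite (mulrC 'X_u) mulrCA; apply: edge_idealMl.
  rewrite mulrC edge_idealX // int //.
  by rewrite inE mp orbT.
have [z [zA hz zE z0]] := alternating_lift A_homog (alternating_koszul EA)
  (fun B => koszul_homog B hE) EI.
(* [A] is prepended: [D' 0] is quadratic and all later maps are linear, as the zigzag requires. *)
pose r' j := if j is i.+1 then r i else 1%N.
pose D' j : 'M[S]_(r' j.+1, r' j) := if j is i.+1 then D i else A.
have D'_exact j (v : 'rV_(r' j.+1)) : v *m D' j = 0 <-> exists w, v = w *m D' j.+1.
  by case: j v => [|j] v; [apply: A_exact | apply: D_exact].
(* The bound is [size p] because [koszul E] lives on words one letter shorter than [p]. *)
have [||y [yA hy] yE] :=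
    @linear_zigzag K n r' D' D'_exact D_linear (size p) 0%N z zA hz.
- move=> B leB; apply: z0; rewrite /koszul big1 // => m _.
  rewrite /E /perm_sign ifN ?mpolyC0 ?scale0r ?scaler0 //.
  by apply: contraL leB => /perm_size /= <-; rewrite -ltnNge.
- move=> B; rewrite -koszulM -[RHS](koszulK B EA).
  by apply: eq_bigr => i _; rewrite zE.
(* A Koszul cycle over S itself that agrees with [E] modulo the edge ideal, hence has the same
   coefficients at non-edges. *)
pose g B := E B - y B *m A.
have gA : alternating g.
  apply: alternatingB => // C a b F; rewrite (yA C a b F).1 (yA C a b F).2.
  by rewrite mulNmx mul0mx.
have g0 B : koszul g B = 0.
  rewrite koszulB koszulM zE; have [w ->] := yE B.
  rewrite mulmxDl -mulmxA (_ : D' 1 *m A = 0) ?mulmx0 ?addr0 ?subrr //.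
  apply/row_matrixP => a; rewrite row_mul row0.
  by apply/A_exact; exists (delta_mx 0 a); rewrite rowE.
pose c a b B := (g B 0 0)@_(U_(a) + U_(b))%MM.
have c_nonadj a b B : a != b -> ~~ e a b -> c a b B =
    perm_sign p B * ((U_(u) + U_(x))%MM == (U_(a) + U_(b))%MM)%:R.
  move=> neab nab; rewrite /c !mxE mcoeffB [X in _ - X](mcoeff_edge_ideal (e := e)) //.
    by rewrite subr0 mulr1n -mpolyXD mcoeffCM mcoeffX.
  by have := edge_ideal_mulmx (y B) A_edge 0; rewrite mxE.
have c_perm a b B B' : perm_eq B B' -> c a b B' != 0 -> c a b B != 0.
  move=> eqB; apply: contra_neq => c0.
  rewrite /c (alternating_perm gA (B' := B)) ?(perm_sym B') // mxE.
  rewrite -signr_odd; case: (odd _).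
    by rewrite expr1 mulN1r mcoeffN -/(c a b B) c0 oppr0.
  by rewrite expr0 mul1r -/(c a b B) c0.
clearbody g.
(* Coefficient of ['X_a * 'X_b * 'X_d] in [koszul g B = 0]. *)
have cocycle a b d B : uniq [:: a; b; d] ->
    c b d (a :: B) + c a d (b :: B) + c a b (d :: B) = 0.
  move=> uabd.
  have := mcoeff_sumXM (fun i => g (i :: B) 0 0)
    (m := (U_(a) + U_(b) + U_(d))%MM) uabd.
  have -> : \sum_i 'X_i * g (i :: B) 0 0 = 0.
    have /rowP/(_ 0) := g0 B; rewrite [RHS]mxE => g0'; rewrite -[RHS]g0'.
    by rewrite summxE; apply: eq_bigr => i _; rewrite [RHS]mxE.
  rewrite mcoeff0 !big_cons big_nil addr0 addrA /c.
  have -> : (U_(a) + U_(b) + U_(d) - U_(a) = U_(b) + U_(d) :> 'X_{1..n})%MM.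
    by rewrite -addmA addmC addmK.
  have -> : (U_(a) + U_(b) + U_(d) - U_(b) = U_(a) + U_(d) :> 'X_{1..n})%MM.
    by rewrite -addmA [(U_(b) + _)%MM]addmC addmA addmK.
  rewrite addmK => -> // i; rewrite !mnmDE !mnm1E !inE ![i == _]eq_sym.
  by do 3!case: (_ == i).
(* In the triangle on [u], [v], [v'], the side from [v] to [v'] is a non-edge without [u], so its
   coefficient vanishes and the other two are opposite. *)
have nonzero q v B : path (fun i j => ~~ e i j) v q -> uniq (v :: q) ->
    {subset v :: q <= x :: p} -> perm_eq (v :: B) (x :: p) -> c u v B != 0 ->
    exists2 B', perm_eq (last v q :: B') (x :: p) & c u (last v q) B' != 0.
  elim: q v B => [|v' q IHq] v B /=; first by exists B.
  case/andP => nvv' pthq /andP[vnq uq] sub eqB cB.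
  have v'p : v' \in x :: p by apply: sub; rewrite !inE eqxx orbT.
  have vp : v \in x :: p by apply: sub; rewrite !inE eqxx.
  have nevv' : v != v' by apply: contraNneq vnq => ->; rewrite mem_head.
  have neuv : u != v by apply: contraNneq uW => ->.
  have neuv' : u != v' by apply: contraNneq uW => ->.
  have v'B : v' \in B.
    by move: v'p; rewrite -(perm_mem eqB) inE eq_sym (negPf nevv').
  have eqB' := perm_to_rem v'B.
  apply: (IHq v' (v :: rem v' B)) => //.
  - by move=> w wq; apply: sub; rewrite inE wq orbT.
  - rewrite -(permPr eqB) -cat1s -[v :: rem _ _]cat1s perm_catCA /= perm_cons.
    by rewrite perm_sym.
  have := cocycle u v v' (rem v' B); rewrite /= !inE negb_or neuv neuv' nevv'.
  move=> /(_ isT); rewrite [c v v' _]c_nonadj //.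
  have /negPf -> : (U_(u) + U_(x))%MM != (U_(v) + U_(v'))%MM :> 'X_{1..n}.
    apply/negP => /eqP/mnmP/(_ u); rewrite !mnmDE !mnm1E eqxx.
    by rewrite ![_ == u]eq_sym (negPf neuv) (negPf neuv').
  rewrite mulr0 add0r => /eqP; rewrite addr_eq0 => /eqP ->.
  by rewrite oppr_eq0; apply: c_perm cB; rewrite perm_sym.
(* The coefficient is a sign at [x], but zero at [l], as the non-edge from [u] to [l] is not the one
   from [u] to [x]. *)
have [||||B' _] := nonzero p x p pth => //.
  rewrite c_nonadj // eqxx mulr1 /perm_sign perm_refl.
  by rewrite signr_eq0.
rewrite -/l c_nonadj // eqm_add2l.
have /negPf -> : U_(x)%MM != U_(l)%MM :> 'X_{1..n}.
  by apply/negP => /eqP/mnmP/(_ x); rewrite !mnm1E eqxx (negPf nelx).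
by rewrite mulr0 eqxx.
Qed.

End NoFan.

(** * Comparison of minimal graded resolutions *)

Section Comparison.

Variables (K : fieldType) (n : nat).
Local Notation S := {mpoly K[n]}.

(** Degree-preserving maps between graded free modules with generator degrees [p] and [q]. *)
Definition graded_mx r s (p : 'I_r -> nat) (q : 'I_s -> nat)
    (M : 'M[S]_(r, s)) : Prop :=
  forall a b, M a b = 0 \/
    exists2 k : nat, p a = (q b + k)%N & M a b \is k.-homog.

Definition graded_part r s (p : 'I_r -> nat) (q : 'I_s -> nat)
    (M : 'M[S]_(r, s)) : 'M[S]_(r, s) :=
  \matrix_(a, b) if (q b <= p a)%N then pihomog mdeg (p a - q b) (M a b) else 0.

Lemma graded_partP r s (p : 'I_r -> nat) (q : 'I_s -> nat) (M : 'M[S]_(r, s)) :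
  graded_mx p q (graded_part p q M).
Proof.
move=> a b; rewrite mxE; case: ifP => [leqp|_]; last by left.
by right; exists (p a - q b)%N; [rewrite subnKC | exact: pihomogP].
Qed.

Lemma graded_part_id r s (p : 'I_r -> nat) (q : 'I_s -> nat)
    (M : 'M[S]_(r, s)) : graded_mx p q M -> graded_part p q M = M.
Proof.
move=> hM; apply/matrixP => a b; rewrite mxE.
case: (hM a b) => [->|[k pqk hk]]; first by rewrite pihomog0; case: ifP.
by rewrite pqk leq_addr addKn pihomog_dE.
Qed.

(** Lets a solution of a graded linear equation be replaced by its degree-preserving part. *)
Lemma graded_partM r s t (p : 'I_r -> nat) (q : 'I_s -> nat) (d : 'I_t -> nat)
    (M : 'M[S]_(r, s)) (N : 'M[S]_(s, t)) : graded_mx q d N ->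
  graded_part p d (M *m N) = graded_part p q M *m N.
Proof.
move=> hN; apply/matrixP => a c; rewrite !mxE.
transitivity (\sum_b if (d c <= p a)%N
    then pihomog mdeg (p a - d c) (M a b * N b c) else 0).
  by case: ifP => _; [rewrite raddf_sum | rewrite big1].
apply: eq_bigr => b _; rewrite mxE.
case: (hN b c) => [->|[k qdk hk]].
  by rewrite !mulr0 pihomog0; case: ifP.
rewrite (pihomogM _ _ hk) qdk.
have [ledp|ltpd] := leqP (d c) (p a).
  by rewrite subnDA leq_subRL //; case: ifP => _; rewrite ?mul0r.
by rewrite leqNgt (leq_trans ltpd) ?leq_addr //= mul0r.
Qed.

Lemma graded_mxM r s t (p : 'I_r -> nat) (q : 'I_s -> nat) (d : 'I_t -> nat)
    (M : 'M[S]_(r, s)) (N : 'M[S]_(s, t)) :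
  graded_mx p q M -> graded_mx q d N -> graded_mx p d (M *m N).
Proof.
move=> hM hN; rewrite -(graded_part_id hM) -(graded_partM _ _ hN).
exact: graded_partP.
Qed.

Lemma mulmx_lift r s t (M : 'M[S]_(r, s)) (D : 'M[S]_(t, s)) :
  (forall a, exists w, row a M = w *m D) -> exists Y, M = Y *m D.
Proof.
case/choice => w wP; exists (\matrix_a w a).
by apply/row_matrixP => a; rewrite row_mul rowK.
Qed.

Lemma mcoeff0_mulmx r s t (M : 'M[S]_(r, s)) (N : 'M[S]_(s, t)) a b :
  ((M *m N) a b)@_0 = \sum_c (M a c)@_0 * (N c b)@_0.
Proof. by rewrite mxE raddf_sum; apply: eq_bigr => c _; rewrite /= rmorphM. Qed.

Variables (A I : {pred S}).
Hypotheses (I0 : 0 \in I)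
  (I_lin : forall a, {in I &, forall u v, a * u + v \in I})
  (I_homog : forall d u, u \in I -> pihomog mdeg d u \in I).

Let ID u v : u \in I -> v \in I -> u + v \in I.
Proof. by move=> uI vI; rewrite -[u]mul1r I_lin. Qed.

Let I_mulmx r s (M : 'M[S]_(r, s)) (N : 'cV[S]_s) :
  (forall b, N b 0 \in I) -> forall a, (M *m N) a 0 \in I.
Proof.
move=> NI a; rewrite mxE; elim/big_ind: _ => // b _.
by rewrite -[_ * _]addr0 I_lin.
Qed.

Lemma resolution_lift_aug (F : free_complex K n) r (X : 'M[S]_(r, rk F 0)) :
  graded_resolution A I F -> (forall a, (X *m aug F) a 0 \in I) ->
  exists Y, X = Y *m diff F 0.
Proof.
case=> _ _ _ ex0 _ XI; apply: mulmx_lift => a; apply/ex0.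
by rewrite -row_mul mxE.
Qed.

Lemma resolution_lift (F : free_complex K n) i r (X : 'M[S]_(r, rk F i.+1)) :
  graded_resolution A I F -> X *m diff F i = 0 ->
  exists Y, X = Y *m diff F i.+1.
Proof.
case=> _ _ _ _ ex X0; apply: mulmx_lift => a; apply/ex.
by rewrite -row_mul X0 row0.
Qed.

Lemma resolution_dd (F : free_complex K n) i :
  graded_resolution A I F -> diff F i.+1 *m diff F i = 0.
Proof.
case=> _ _ _ _ ex; apply/row_matrixP => a; rewrite row_mul row0.
by apply/ex; exists (delta_mx 0 a); rewrite rowE.
Qed.

Lemma resolution_d_aug (F : free_complex K n) a :
  graded_resolution A I F -> (diff F 0 *m aug F) a 0 \in I.
Proof.
case=> _ _ _ ex0 _; have -> : (diff F 0 *m aug F) a 0 =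
    (row a (diff F 0) *m aug F) 0 0 by rewrite -row_mul [RHS]mxE.
by apply/ex0; exists (delta_mx 0 a); rewrite rowE.
Qed.

(** The induction invariant. [h] is the homotopy at level [i]; [X] is the contribution of the
    homotopy one level below, remembered only through the two properties used later. *)
Definition comparable_at (F G : free_complex K n) i : Prop :=
  exists f : 'M[S]_(rk F i, rk G i), exists2 g : 'M[S]_(rk G i, rk F i),
    [/\ graded_mx (@gdeg _ _ F i) (@gdeg _ _ G i) f,
        graded_mx (@gdeg _ _ G i) (@gdeg _ _ F i) g,
        exists Y, diff F i *m f = Y *m diff G i
      & exists Y, diff G i *m g = Y *m diff F i] &
    exists h : 'M[S]_(rk F i, rk F i.+1), exists X : 'M[S]_(rk F i),
      [/\ f *m g - 1%:M = X + h *m diff F i, diff F i *m X = 0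
        & forall a b, (X a b)@_0 = 0].

(** Lift [aug F] through [aug G] modulo [I] and take the degree-preserving part; the congruence
    survives because [I] is homogeneous. *)
Lemma graded_aug_lift (F G : free_complex K n) :
  graded_resolution A I F -> graded_resolution A I G ->
  exists2 f : 'M[S]_(rk F 0, rk G 0),
    graded_mx (@gdeg _ _ F 0) (@gdeg _ _ G 0) f &
    forall a, (f *m aug G - aug F) a 0 \in I.
Proof.
case=> augF _ _ _ _ [augG _ surjG _ _].
have /choice[f0 f0P] : forall a : 'I_(rk F 0), exists v : 'rV[S]_(rk G 0),
    aug F a 0 - (v *m aug G) 0 0 \in I.
  by move=> a; apply: surjG; case: (augF a).
pose f := \matrix_a f0 a; pose z (r : nat) (_ : 'I_r) := 0%N.
have gG : graded_mx (@gdeg _ _ G 0) (@z 1%N) (aug G).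
  move=> b c; rewrite ord1; right; exists (gdeg b) => //.
  by case: (augG b).
have gF : graded_mx (@gdeg _ _ F 0) (@z 1%N) (aug F).
  move=> b c; rewrite ord1; right; exists (gdeg b) => //.
  by case: (augF b).
exists (graded_part (@gdeg _ _ F 0) (@gdeg _ _ G 0) f); first exact: graded_partP.
have fE a : (f *m aug G) a 0 = (f0 a *m aug G) 0 0.
  by rewrite !mxE; apply: eq_bigr => b _; rewrite mxE.
move=> a; rewrite -(graded_partM _ _ gG) -[aug F](graded_part_id gF).
have -> : (graded_part (@gdeg _ _ F 0) (@z 1%N) (f *m aug G) -
    graded_part (@gdeg _ _ F 0) (@z 1%N) (aug F)) a 0 =
    -1 * pihomog mdeg (gdeg a) (aug F a 0 - (f0 a *m aug G) 0 0) + 0.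
  rewrite -fE mulN1r addr0 raddfB opprB 2!mxE [X in _ + X]mxE.
  by rewrite [in X in - X]mxE /= subn0.
by rewrite I_lin // I_homog.
Qed.

Lemma graded_diff_lift (F G : free_complex K n) i
    (f : 'M[S]_(rk F i, rk G i)) :
  graded_resolution A I F -> graded_resolution A I G ->
  graded_mx (@gdeg _ _ F i) (@gdeg _ _ G i) f ->
  (exists Y, diff F i *m f = Y *m diff G i) ->
  exists f', [/\ graded_mx (@gdeg _ _ F i.+1) (@gdeg _ _ G i.+1) f',
    diff F i *m f = f' *m diff G i
    & exists Y, diff F i.+1 *m f' = Y *m diff G i.+1].
Proof.
move=> resF resG gf [Y YE].
have [_ gF _ _ _] := resF; have [_ gG _ _ _] := resG.
have E : diff F i *m f =
    graded_part (@gdeg _ _ F i.+1) (@gdeg _ _ G i.+1) Y *m diff G i.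
  rewrite -(graded_partM _ _ (gG i)) -YE graded_part_id //.
  exact: graded_mxM (gF i) gf.
exists (graded_part (@gdeg _ _ F i.+1) (@gdeg _ _ G i.+1) Y); split=> //.
  exact: graded_partP.
apply: resolution_lift resG _.
by rewrite -mulmxA -E mulmxA resolution_dd // mul0mx.
Qed.

Lemma comparable (F G : free_complex K n) i :
  minimal_resolution A I F -> minimal_resolution A I G -> comparable_at F G i.
Proof.
move=> [resF minF] [resG minG].
have lift0 (H J : free_complex K n) (f : 'M[S]_(rk H 0, rk J 0)) :
    graded_resolution A I H -> graded_resolution A I J ->
    (forall a, (f *m aug J - aug H) a 0 \in I) ->
    exists Y, diff H 0 *m f = Y *m diff J 0.
  move=> resH resJ fI; apply: resolution_lift_aug (resJ) _ => a.
  rewrite -mulmxA -[f *m _](subrK (aug H)) mulmxDr mxE ID ?resolution_d_aug //.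
  exact: I_mulmx.
elim: i => [|i [f [g [gf gg fY gY] [h [X [fgE dX X0]]]]]].
  have [f gf fI] := graded_aug_lift resF resG.
  have [g gg gI] := graded_aug_lift resG resF.
  exists f; exists g; first by split=> //; apply: lift0.
  have [h hE] : exists h, f *m g - 1%:M = h *m diff F 0.
    apply: resolution_lift_aug (resF) _ => a.
    rewrite mulmxBl mul1mx -mulmxA -[g *m _](subrK (aug G)) mulmxDr -addrA mxE.
    by rewrite ID // I_mulmx.
  exists h; exists 0; split; rewrite ?add0r ?mulmx0 // => a b.
  by rewrite mxE mcoeff0.
have [f' [gf' fE' fY']] := graded_diff_lift resF resG gf fY.
have [g' [gg' gE' gY']] := graded_diff_lift resG resF gg gY.
exists f'; exists g' => //.
(* The left side is a cycle by the chain map identities and [diff F i *m X = 0]. The next [X] is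
   [diff F i *m h], whose constant coefficients vanish by minimality. *)
have [h' hE'] : exists h', f' *m g' - 1%:M - diff F i *m h = h' *m diff F i.+1.
  apply: resolution_lift (resF) _.
  rewrite !mulmxBl mul1mx -[f' *m g' *m _]mulmxA -gE' mulmxA -fE'.
  rewrite -!mulmxA -{2}[diff F i]mulmx1 -!mulmxBr fgE.
  by rewrite -addrA subrr addr0.
exists h'; exists (diff F i *m h); split.
- by rewrite -hE' [RHS]addrC subrK.
- by rewrite mulmxA resolution_dd // mul0mx.
- by move=> a b; rewrite mcoeff0_mulmx big1 // => c _; rewrite minF mul0r.
Qed.

(** The diagonal entries of [f *m g] have constant coefficient 1, so row [a] of [f] has an entry
    with nonzero constant coefficient; being homogeneous, it has degree 0. *)
Lemma minimal_resolution_gdeg (F G : free_complex K n) i (a : 'I_(rk F i)) :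
  minimal_resolution A I F -> minimal_resolution A I G ->
  exists b : 'I_(rk G i), gdeg b = gdeg a.
Proof.
move=> minF minG.
have [f [g [gf _ _ _] [h [X [fgE _ X0]]]]] := comparable i minF minG.
have fg1 : ((f *m g) a a)@_0 = 1.
  rewrite -[f *m g](subrK 1%:M) fgE mxE mcoeffD mxE mcoeffD X0 add0r.
  rewrite mcoeff0_mulmx big1 => [|c _]; last by rewrite minF.2 mulr0.
  by rewrite add0r !mxE eqxx mcoeff1 eqxx.
have [/existsP[b fb]|/existsPn none] := boolP [exists b, (f a b)@_0 != 0].
  exists b; case: (gf a b) fb => [->|[k -> hk]]; first by rewrite mcoeff0 eqxx.
  have [->|k0] := eqVneq k 0%N; first by rewrite addn0.
  by rewrite (dhomog_nemf_coeff hk) ?eqxx //= mdeg0 eq_sym.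
move: fg1; rewrite mcoeff0_mulmx big1 => [/eqP|c _].
  by rewrite eq_sym oner_eq0.
by move: (none c); rewrite negbK => /eqP ->; rewrite mul0r.
Qed.

End Comparison.

(** * The colon ideal of a vertex with independent non-neighbours *)

Section SimplicialColon.

Variables (K : fieldType) (n : nat) (e : rel 'I_n) (i : 'I_n).
Local Notation S := {mpoly K[n]}.
Hypothesis e_irr : irreflexive e.
Hypothesis simpl_i : forall j k, ~~ e i j -> ~~ e i k -> ~~ e j k.

(** The prime generated by the neighbours of [i] is handled as the kernel of this substitution,
    which makes primality immediate. *)
Definition kill_nbrs : n.-tuple S := [tuple if e i j then 0 else 'X_j | j < n].

Lemma kill_nbrsX j : 'X_j \mPo kill_nbrs = if e i j then 0 else 'X_j.
Proof. by rewrite comp_mpolyXU -tnth_nth tnth_mktuple. Qed.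

(** The polynomials with this property include constants and variables and are closed under sums and
    products. *)
Lemma sub_kill_nbrs g : (g - (g \mPo kill_nbrs)) * 'X_i \in edge_ideal K e.
Proof.
pose P (g : S) := (g - (g \mPo kill_nbrs)) * 'X_i \in edge_ideal K e.
have PM f h : P f -> P h -> P (f * h).
  move=> Pf Ph; rewrite /P rmorphM /=.
  have -> : (f * h - (f \mPo kill_nbrs) * (h \mPo kill_nbrs)) * 'X_i =
      h * ((f - (f \mPo kill_nbrs)) * 'X_i) +
      (f \mPo kill_nbrs) * ((h - (h \mPo kill_nbrs)) * 'X_i).
    rewrite !mulrBl !mulrBr !mulrA [h * f]mulrC.
    by rewrite [h * (f \mPo _)]mulrC addrA subrK.
  by apply: edge_idealD; apply: edge_idealMl.
have P1 : P 1 by rewrite /P rmorph1 subrr mul0r edge_ideal0.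
have PX j : P 'X_j.
  rewrite /P kill_nbrsX; case: ifPn => eij; last first.
    by rewrite subrr mul0r edge_ideal0.
  by rewrite subr0 mulrC edge_idealX.
rewrite -/(P g); elim/mpolyind: g => [|c m g _ _ Pg].
  by rewrite /P comp_mpoly0 subrr mul0r edge_ideal0.
rewrite /P comp_mpolyD opprD addrACA mulrDl edge_idealD //.
rewrite comp_mpolyZ -scalerBr -scalerAl -mul_mpolyC edge_idealMl //.
rewrite -/(P _) mpolyXE_id; elim/big_ind: _ => // j _.
by elim: (m j) => [|k IHk]; rewrite ?expr0 // exprS; apply: PM.
Qed.

(** By [simpl_i] every edge meets a neighbour of [i], so the substitution annihilates the edge
    ideal; it fixes ['X_i], and S is a domain. The converse is [sub_kill_nbrs]. *)
Lemma colon_simplicial g :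
  (g \in colon (edge_ideal K e) 'X_i) = ((g \mPo kill_nbrs) == 0).
Proof.
apply/idP/eqP => [|g0]; last first.
  by have := sub_kill_nbrs g; rewrite g0 subr0.
rewrite inE => /edge_idealP[c /(congr1 (comp_mpoly kill_nbrs))].
rewrite rmorphM /= kill_nbrsX e_irr rmorph_sum big1 /= => [/eqP|j _].
  rewrite mulf_eq0 => /orP[/eqP //|/eqP/(congr1 (mcoeff U_(i)))].
  by rewrite mcoeffX eqxx mcoeff0 => /eqP; rewrite oner_eq0.
rewrite rmorph_sum big1 //= => k ejk; rewrite !rmorphM /= !kill_nbrsX.
case: ifPn => nij; first by rewrite mul0r mulr0.
case: ifPn => nik; first by rewrite !mulr0.
by have := simpl_i nij nik; rewrite ejk.
Qed.

Lemma v_degree1 : v_degree (edge_ideal K e) 1.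
Proof.
split=> //; exists 'X_i, (colon (edge_ideal K e) 'X_i).
split=> //; first by rewrite dhomogX /= mdeg1.
split; last by exists 'X_i.
- split; rewrite ?colon_simplicial ?comp_mpoly0 ?eqxx // ?rmorph1 ?oner_eq0 //.
  move=> a u v; rewrite !colon_simplicial => /eqP u0 /eqP v0.
  by rewrite rmorphD rmorphM /= u0 v0 mulr0 addr0.
- by move=> u v; rewrite !colon_simplicial rmorphM /= mulf_eq0.
Qed.

End SimplicialColon.

(** * From a resolution of the ideal to one of the quotient *)

Section Augmentation.

Variables (K : fieldType) (n : nat) (F : free_complex K n).
Local Notation S := {mpoly K[n]}.

Definition augmented_rk (i : nat) : nat := if i is j.+1 then rk F j else 1%N.

Definition augmented_gdeg (i : nat) : 'I_(augmented_rk i) -> nat :=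
  match i with 0 => fun=> 0%N | j.+1 => @gdeg _ _ F j end.

Definition augmented_diff (i : nat) :
    'M[S]_(augmented_rk i.+1, augmented_rk i) :=
  match i with 0 => aug F | j.+1 => diff F j end.

(* A resolution of I, extended by S -> S/I. *)
Definition augmented : free_complex K n :=
  @FreeComplex K n augmented_rk augmented_gdeg (const_mx 1) augmented_diff.

(** The new first map [aug F] is minimal because its entries are homogeneous of positive degree. *)
Lemma augmented_minimal (e : rel 'I_n) :
  minimal_resolution (edge_ideal K e) (@zero_ideal K n) F ->
  (forall a : 'I_(rk F 0), gdeg a != 0%N) ->
  minimal_resolution (@whole_ring K n) (edge_ideal K e) augmented.
Proof.
case=> -[augF gF surjF ex0 ex] minF gdeg0; split; last first.
  move=> [|i] a b /=; last exact: minF.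
  have [_ h] := augF a; rewrite ord1 (dhomog_nemf_coeff h) //= mdeg0 eq_sym.
  exact: gdeg0.
split.
- by move=> a; rewrite mxE; split; [rewrite inE | exact: dhomog1].
- move=> [|i] a b /=; last exact: gF.
  by right; exists (gdeg a); rewrite // ord1; case: (augF a).
- move=> f _; exists f%:M; rewrite /= mul_scalar_mx !mxE mulr1 subrr.
  exact: edge_ideal0.
- move=> v; rewrite /=.
  have -> : v *m const_mx 1 = v.
    by apply/rowP => a; rewrite !ord1 mxE big_ord1 mxE mulr1.
  split=> [/surjF[w]|[w ->]].
    rewrite inE subr_eq0 => /eqP vw; exists w.
    by apply/rowP => a; rewrite !ord1.
  by apply: edge_ideal_mulmx => a; case: (augF a).
move=> [|i] v /=; last exact: ex.
rewrite -ex0 inE; split=> [->|/eqP v0]; first by rewrite mxE.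
by apply/rowP => a; rewrite !ord1 v0 mxE.
Qed.

End Augmentation.

(** * Betti numbers and regularity of the quotient *)

Section LinearRegularity.

Variables (K : fieldType) (n : nat) (e : rel 'I_n).
Local Notation I := (edge_ideal K e).

(** [betti] counts in some unspecified minimal resolution; which degrees occur does not depend on
    that choice. *)
Lemma betti_neq0 (G : free_complex K n) i j :
  minimal_resolution (@whole_ring K n) I G ->
  betti (@whole_ring K n) I i j <> 0%N <-> exists a : 'I_(rk G i), gdeg a = j.
Proof.
move=> minG; rewrite /betti.
have [b bE [F minF bF]|none] := classical_sets.xgetP; last first.
  by case: (none #|[set a : 'I_(rk G i) | gdeg a == j]|); exists G.
have move_gdeg (H H' : free_complex K n) (a : 'I_(rk H i)) :
    minimal_resolution (@whole_ring K n) I H ->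
    minimal_resolution (@whole_ring K n) I H' ->
    exists a' : 'I_(rk H' i), gdeg a' = gdeg a.
  apply: minimal_resolution_gdeg; first exact: edge_ideal0.
  - exact: edge_ideal_lin.
  - exact: pihomog_edge_ideal.
rewrite bF; split.
  move/eqP; rewrite cards_eq0 => /set0Pn[a]; rewrite inE => /eqP <-.
  exact: move_gdeg.
case=> a <-; have [a' a'E] := move_gdeg _ _ a minG minF.
by apply/eqP; rewrite cards_eq0; apply/set0Pn; exists a'; rewrite inE a'E.
Qed.

Lemma reg_linear (F : free_complex K n) i j : e i j ->
  minimal_resolution I (@zero_ideal K n) F ->
  (forall k (a : 'I_(rk F k)), gdeg a = (2 + k)%N) ->
  reg_quotient I = 1.
Proof.
move=> eij minF degF.
have minA : minimal_resolution (@whole_ring K n) I (augmented F).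
  by apply: augmented_minimal => // a; rewrite degF.
have betti12 : betti (@whole_ring K n) I 1 2 <> 0%N.
  apply/(betti_neq0 1 2 minA).
  have [[_ _ surjF _ _] _] := minF.
  have [v] := surjF _ (edge_idealX K eij).
  (* Without generators, ['X_i * 'X_j] would lie in the zero ideal. *)
  case: (posnP (rk F 0)) => [rk0 +|rk0 _]; last by exists (Ordinal rk0); apply: degF.
  have no_gen (a : 'I_(rk F 0)) : False by case: a => m; rewrite rk0.
  rewrite mxE big1 => [|a]; last by case: (no_gen a).
  rewrite subr0 inE -mpolyXD => /eqP/(congr1 (mcoeff (U_(i) + U_(j))%MM)).
  by rewrite mcoeffX eqxx mcoeff0 => /eqP; rewrite oner_eq0.
have le1 k l : betti (@whole_ring K n) I k l <> 0%N -> l%:Z - k%:Z <= 1.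
  move/(betti_neq0 k l minA) => [a <-]; case: k a => [|k] a //=.
  by rewrite degF addSn add1n -addn1 PoszD addrAC subrr add0r.
apply: classical_sets.xget_unique => [|r [[k [l [bkl ->]]] ub]].
  by split=> //; exists 1%N, 2%N.
by apply/eqP; rewrite eq_le le1 //=; apply: (ub 1%N 2%N).
Qed.

End LinearRegularity.

Theorem proposition3p19 (K : fieldType) (s : nat) (hs : (1 <= s)%N)
    (e : rel 'I_s) (e_sym : ssrbool.symmetric e) (e_irr : irreflexive e)
    (no_isolated : forall i : 'I_s, exists j : 'I_s, e i j)
    (hlin : linear_resolution 2 (edge_ideal K e)) :
  (vnumber (edge_ideal K e))%:Z = reg_quotient (edge_ideal K e) /\
  reg_quotient (edge_ideal K e) = 1.
Proof.
case: hlin => F minF degF; have [j eij] := no_isolated (Ordinal hs).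
have reg1 := reg_linear eij minF degF; rewrite reg1; split=> //.
have [[augF gF surjF ex0 ex] _] := minF.
have no_fan u x p : ~ fan e u x p.
  apply: (@linear_no_fan K s e e_sym e_irr (rk F) (aug F) (diff F)).
  - by move=> a; case: (augF a).
  - by move=> a b; rewrite ord1; case: (augF a) => _; rewrite degF.
  - move=> f /surjF[w]; rewrite inE subr_eq0 => /eqP fw; exists w.
    by apply/rowP => a; rewrite !ord1 -fw mxE.
  - move=> v; rewrite -ex0 inE; split=> [->|/eqP v0]; first by rewrite mxE.
    by apply/rowP => a; rewrite !ord1 v0 mxE.
  - exact: ex.
  (* Generators in degrees [2 + k.+1] and [2 + k] force nonzero entries to be linear. *)
  - move=> k a b; case: (gF k a b) => [->|[l]]; first exact: rpred0.
    by rewrite !degF addnS -addn1 => /addnI <-.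
have [|i _ simpl_i] := @simplicial_vertex s e e_sym e_irr no_fan [set: 'I_s].
  by apply/set0Pn; exists (Ordinal hs); rewrite inE.
(* Degree 1 is attained at ['X_i], and [v_degree] admits no smaller degree. *)
congr Posz; apply: classical_sets.xget_unique => [|d [[d0 _] dmin]].
  split=> [|d [] //]; apply: (@v_degree1 K s e i) => // k l.
  by apply: simpl_i; rewrite inE.
apply/eqP; rewrite eqn_leq d0 andbT; apply: dmin.
by apply: (@v_degree1 K s e i) => // k l; apply: simpl_i; rewrite inE.
Qed.
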